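(* Let $\mathbb{F}$ be a division ring, $n$ a positive integer, $\sigma:\mathbb{F}\to\mathbb{F}^{n\times n}$ a ring morphism and $\delta:\mathbb{F}\to\mathbb{F}^n$ a $\sigma$-derivation. For all $\mathbf{a}\in\mathbb{F}^n$, the set $K_{\mathbf{a}}=\{\beta\in\mathbb{F}\mid\mathcal{D}_{\mathbf{a}}(\beta)=\mathbf{a}\beta\}$ is a division subring of $\mathbb{F}$. Moreover, for every $F^{\mathcal{D}_{\mathbf{a}}}\in\mathbb{F}[\mathcal{D}_{\mathbf{a}}]$, the map $\beta\mapsto F^{\mathcal{D}_{\mathbf{a}}}(\beta)$, for $\beta\in\mathbb{F}$, is right linear over $K_{\mathbf{a}}$.
   Context: Rings are associative with identity, not necessarily commutative, and ring morphisms preserve identities. $\mathbb{F}^n$ denotes column vectors. A map $\delta:\mathbb{F}\to\mathbb{F}^n$ is a $\sigma$-derivation if $\delta(a+b)=\delta(a)+\delta(b)$ and $\delta(ab)=\sigma(a)\delta(b)+\delta(a)b$ for all $a,b\in\mathbb{F}$. Linearized polynomials: let $\mathcal{M}$ be the free monoid on variables $x_1,\dots,x_n$. Define $\mathcal{D}_{\mathbf{a}}:\mathbb{F}\to\mathbb{F}^n$ by $\mathcal{D}_{\mathbf{a}}(\beta)=\sigma(\beta)\mathbf{a}+\delta(\beta)$. Define maps $\mathcal{D}_{\mathbf{a}}^{\mathfrak{m}}:\mathbb{F}\to\mathbb{F}$ for $\mathfrak{m}\in\mathcal{M}$ recursively by $\mathcal{D}_{\mathbf{a}}^{1}=\mathrm{Id}$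 and $\mathcal{D}_{\mathbf{a}}^{x_i\mathfrak{m}}(\beta)=$ the $i$-th component of $\mathcal{D}_{\mathbf{a}}(\mathcal{D}_{\mathbf{a}}^{\mathfrak{m}}(\beta))$. $\mathbb{F}[\mathcal{D}_{\mathbf{a}}]$ is the left $\mathbb{F}$-vector space of maps $\mathbb{F}\to\mathbb{F}$ generated by $\{\mathcal{D}_{\mathbf{a}}^{\mathfrak{m}}\mid\mathfrak{m}\in\mathcal{M}\}$; its elements are written $F^{\mathcal{D}_{\mathbf{a}}}=\sum_{\mathfrak{m}}F_{\mathfrak{m}}\mathcal{D}_{\mathbf{a}}^{\mathfrak{m}}$ with $F^{\mathcal{D}_{\mathbf{a}}}(\beta)=\sum_{\mathfrak{m}}F_{\mathfrak{m}}\mathcal{D}_{\mathbf{a}}^{\mathfrak{m}}(\beta)$. *)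

(* Defs.v *)
From HB Require Import structures.
From mathcomp Require Import all_boot all_order all_algebra.
From mathcomp Require Import finmap.

Set Implicit Arguments.
Unset Strict Implicit.
Unset Printing Implicit Defensive.

Import GRing.Theory.
Local Open Scope ring_scope.

(* A [unitRingType] is nontrivial, not necessarily commutative, and its units
   have two-sided inverses, so despite its name [GRing.field_axiom] gives a
   division ring here. *)
Definition division_ring (F : unitRingType) : Prop := GRing.field_axiom F.

(* [*:] is the left action of F, hence a separate right scaling. *)
Definition rscale (F : unitRingType) (n : nat) (v : 'cV[F]_n) (b : F) :
  'cV[F]_n := \col_i (v i 0 * b).

Definition sigma_derivation (F : unitRingType) (n : nat)
    (sigma : {rmorphism F -> 'M[F]_n}) (delta : F -> 'cV[F]_n) : Prop :=
  {morph delta : x y / x + y} /\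
  forall x y, delta (x * y) = sigma x *m delta y + rscale (delta x) y.

Definition Dop (F : unitRingType) (n : nat) (sigma : {rmorphism F -> 'M[F]_n})
    (delta : F -> 'cV[F]_n) (a : 'cV[F]_n) (b : F) : 'cV[F]_n :=
  sigma b *m a + delta b.

(* The free monoid on x_0, ..., x_(n-1) is [seq 'I_n] under concatenation, with
   unit [[::]]; the word x_i m is [i :: m]. *)
Fixpoint Dword (F : unitRingType) (n : nat) (sigma : {rmorphism F -> 'M[F]_n})
    (delta : F -> 'cV[F]_n) (a : 'cV[F]_n) (m : seq 'I_n) (b : F) : F :=
  if m is i :: m' then Dop sigma delta a (Dword sigma delta a m' b) i 0 else b.

(* The left F-span of the maps [Dword sigma delta a m], as a set of maps. *)
Definition linearized (F : unitRingType) (n : nat)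
    (sigma : {rmorphism F -> 'M[F]_n}) (delta : F -> 'cV[F]_n)
    (a : 'cV[F]_n) (f : F -> F) : Prop :=
  exists P : {fsfun seq 'I_n -> F with 0},
    forall b, f b = \sum_(m <- finsupp P) P m * Dword sigma delta a m b.

Definition centralizer (F : unitRingType) (n : nat)
    (sigma : {rmorphism F -> 'M[F]_n}) (delta : F -> 'cV[F]_n)
    (a : 'cV[F]_n) : {pred F} :=
  [pred b | Dop sigma delta a b == rscale a b].

Definition right_linear (F : unitRingType) (K : {pred F}) (f : F -> F) : Prop :=
  {morph f : x y / x + y} /\ forall x c, c \in K -> f (x * c) = f x * c.

(* Main.v *)
Require Import Defs.
From HB Require Import structures.
From mathcomp Require Import all_boot all_order all_algebra.
From mathcomp Require Import finmap.

Set Implicit Arguments.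
Unset Strict Implicit.
Unset Printing Implicit Defensive.

Import GRing.Theory.
Local Open Scope ring_scope.

Section Operator.

Variables (F : unitRingType) (n : nat).
Implicit Types (u v a : 'cV[F]_n) (b c : F).

(** Everything follows from [DopM_centralizer]: the twisted Leibniz rule gives
    [D (b * c) = rscale (D b) c] whenever [c] lies in [K]. With [b] in [K] this yields products,
    with [b = c^-1] inverses, and by induction on words the right linearity of every [Dword], hence
    of their left combinations. *)

Lemma rscaleDl u v b : rscale (u + v) b = rscale u b + rscale v b.
Proof. by apply/matrixP=> i j; rewrite !mxE mulrDl. Qed.

Lemma rscaleBr v b c : rscale v (b - c) = rscale v b - rscale v c.
Proof. by apply/matrixP=> i j; rewrite ord1 !mxE mulrBr. Qed.

Lemma rscale1 v : rscale v 1 = v.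
Proof. by apply/matrixP=> i j; rewrite ord1 !mxE mulr1. Qed.

Lemma rscaleA v b c : rscale (rscale v b) c = rscale v (b * c).
Proof. by apply/matrixP=> i j; rewrite !mxE mulrA. Qed.

Lemma mulmx_rscale (M : 'M[F]_n) v b : M *m rscale v b = rscale (M *m v) b.
Proof.
apply/matrixP=> i j; rewrite !mxE mulr_suml.
by apply: eq_bigr => k _; rewrite !mxE mulrA.
Qed.

Variables (sigma : {rmorphism F -> 'M[F]_n}) (delta : F -> 'cV[F]_n).
Hypothesis hdelta : sigma_derivation sigma delta.
Variable a : 'cV[F]_n.

Local Notation D := (Dop sigma delta a).
Local Notation K := (centralizer sigma delta a).

(** The product rule at [1 * 1] reads [delta 1 = delta 1 + delta 1]. *)
Lemma sigma_derivation1 : delta 1 = 0.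
Proof.
have := hdelta.2 1 1.
rewrite rmorph1 mul1mx rscale1 mulr1 => /eqP.
by rewrite -subr_eq0 opprD addrA subrr sub0r oppr_eq0 => /eqP.
Qed.

Lemma DopD b c : D (b + c) = D b + D c.
Proof. by rewrite /Dop rmorphD hdelta.1 mulmxDl addrACA. Qed.

Lemma DopB b c : D (b - c) = D b - D c.
Proof. by apply/(canRL (addrK _)); rewrite -DopD subrK. Qed.

Lemma Dop1 : D 1 = a.
Proof. by rewrite /Dop rmorph1 mul1mx sigma_derivation1 addr0. Qed.

(* The twisted Leibniz rule is [D (b * c) = sigma b *m D c + rscale (delta b) c];
   substituting [D c = rscale a c] reassembles [D b] on the right-hand side. *)
Lemma DopM_centralizer b c : c \in K -> D (b * c) = rscale (D b) c.
Proof.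
move=> /eqP Dc; rewrite [RHS]rscaleDl -mulmx_rscale -Dc.
by rewrite /Dop rmorphM hdelta.2 mulmxDr mulmxA addrA.
Qed.

(** From [c^-1 * c = 1] one gets [a = D 1 = rscale (D c^-1) c]; scaling by [c^-1] on the right
    isolates [D c^-1]. *)
Lemma centralizerV c : c \in K -> c^-1 \in K.
Proof.
(* By convention a non-unit is its own inverse. *)
move=> Kc; have [Uc|nUc] := boolP (c \is a GRing.unit); last by rewrite invr_out.
apply/eqP; rewrite -[in RHS]Dop1 -(mulVr Uc) DopM_centralizer //.
by rewrite rscaleA mulrV // rscale1.
Qed.

Lemma centralizer_divring_closed : GRing.divring_closed K.
Proof.
split=> [|b c /eqP Db /eqP Dc|b c Kb Kc].
- by apply/eqP; rewrite Dop1 rscale1.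
- by apply/eqP; rewrite DopB Db Dc rscaleBr.
(* The quotient is [b * c^-1], with [c^-1] as the right factor in [K]. *)
- apply/eqP; rewrite DopM_centralizer ?centralizerV //.
  by rewrite (eqP Kb) rscaleA.
Qed.

(** Each letter takes a coordinate of [D], which is additive and commutes with right scaling by
    [K]. *)
Lemma Dword_right_linear m : right_linear K (Dword sigma delta a m).
Proof.
elim: m => [|i m [IHD IHM]]; first by [].
split=> [b c|b c Kc] /=; first by rewrite IHD DopD mxE.
by rewrite IHM // DopM_centralizer // mxE.
Qed.

(** Coefficients multiply on the left, so by associativity they commute with right scaling. *)
Lemma linearized_right_linear f :
  linearized sigma delta a f -> right_linear K f.
Proof.
move=> [P fE]; split=> [b c|b c Kc]; rewrite !fE.
  rewrite -big_split; apply: eq_bigr => m _.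
  by rewrite (Dword_right_linear m).1 mulrDr.
rewrite mulr_suml; apply: eq_bigr => m _.
by rewrite (Dword_right_linear m).2 // mulrA.
Qed.

End Operator.

Theorem lemma8 (F : unitRingType) (hF : division_ring F)
    (n : nat) (hn : (0 < n)%N)
    (sigma : {rmorphism F -> 'M[F]_n}) (delta : F -> 'cV[F]_n)
    (hdelta : sigma_derivation sigma delta) (a : 'cV[F]_n) :
  GRing.divring_closed (centralizer sigma delta a) /\
  forall f : F -> F, linearized sigma delta a f ->
    right_linear (centralizer sigma delta a) f.
Proof.
split; first exact: centralizer_divring_closed.
by move=> f; exact: linearized_right_linear.
Qed.
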